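(* Let $W$ be a finite complex reflection group and $m\ge 1$ an integer. Then there is a natural isomorphism of bigraded $W$-modules $$\mathbf{e_{\det}}\big(D\!R^{(m)}(W)\big)\;\cong\;\big(\mathcal{A}^m/\langle \mathbf{x},\mathbf{y}\rangle\mathcal{A}^m\big)\otimes \epsilon^{\otimes(1-m)},$$ where $\langle \mathbf{x},\mathbf{y}\rangle=\langle x_1,y_1,\dots,x_\ell,y_\ell\rangle$ is the ideal of polynomials without constant term.
   Context: Let $W\subseteq \mathrm{U}(V)$ be a finite complex reflection group of rank $\ell$ acting on $V\cong\mathbb{C}^\ell$. $W$ acts on $V\oplus V^*$ by $\omega(v\oplus v^* )=\omega v\oplus {}^t(\omega^{-1})v^*$, hence (contragrediently) on the ring of polynomial functions $\mathbb{C}[\mathbf{x},\mathbf{y}]=\mathbb{C}[x_1,y_1,\dots,x_\ell,y_\ell]=\mathbb{C}[V\oplus V^*]$ by algebra automorphisms preserving the bigrading by ($\mathbf{x}$-degree, $\mathbf{y}$-degree). For a $W$-module $S$, $\mathbf{e}=\frac1{|W|}\sum_{\omega}\omega$ and $\mathbf{e_{\det}}=\frac1{|W|}\sum_\omega \det^{-1}(\omega)\,\omega$; $\mathbf{e_{\det}}(S)$ is the determinantal component $\{p: \omega(p)=\det(\omega)p\ \forall \omega\}$. A polynomial $p$ is invariant if $\omega(p)=p$ for all $\omega$, determinantal if $\omega(p)=\det(\omega)p$ for all $\omega$. $\epsilon$ is the one-dimensional representation $\omega\cdot z=\det(\omega)z$, $\epsilon^{\otimes k}$ its $k$-th tensor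 power ($\omega\cdot z=\det^k(\omega)z$, $k\in\mathbb{Z}$). $\mathcal{I}$ is the ideal of $\mathbb{C}[\mathbf{x},\mathbf{y}]$ generated by invariant polynomials without constant term, $\mathcal{A}$ the ideal generated by all determinantal polynomials, and the space of generalized diagonal coinvariants is $D\!R^{(m)}(W)=(\mathcal{A}^{m-1}/\mathcal{A}^{m-1}\mathcal{I})\otimes\epsilon^{\otimes(1-m)}$, a bigraded $W$-module. *)

(* Defs.v *)
From HB Require Import structures.
From mathcomp Require Import all_boot all_order all_algebra.
From mathcomp Require Import mpoly.
Set Implicit Arguments. Unset Strict Implicit. Unset Printing Implicit Defensive.
Import Order.TTheory GRing.Theory Num.Theory.
Local Open Scope ring_scope.

Section Defs.
Variable C : numClosedFieldType. (* stands for the complex numbers *)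
Variable l : nat.                (* rank: V = C^l *)

(* Polynomial functions on V (+) V^*: variables 0..l-1 are x_1..x_l,
   variables l..2l-1 are y_1..y_l. *)
Notation P := {mpoly C[l + l]}.
Definition xvar (i : 'I_l) : P := 'X_(lshift l i).
Definition yvar (i : 'I_l) : P := 'X_(rshift l i).

Definition unitary (w : 'M[C]_l) := w *m (map_mx Num.conj w)^T = 1%:M.
Definition is_reflection (r : 'M[C]_l) :=
  \rank (r - 1%:M) = 1%N /\ exists k, (0 < k)%N /\ r ^+ k = 1%:M.
Definition complex_reflection_group (W : seq 'M[C]_l) :=
  [/\ 1%:M \in W,
      (forall a b, a \in W -> b \in W -> a *m b \in W),
      (forall a, a \in W -> a \in unitmx /\ invmx a \in W),
      (forall a, a \in W -> unitary a) &
      (forall a, a \in W -> exists s : seq 'M[C]_l,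
          (forall r, r \in s -> r \in W /\ is_reflection r) /\
          a = foldr mulmx 1%:M s)].

(* (w p)(v, v^* ) = p(w^{-1} v, ^t w v^* ), i.e.
   x_i |-> sum_j (w^{-1})_{ij} x_j,  y_i |-> sum_j w_{ji} y_j *)
Definition act_subst (w : 'M[C]_l) (i : 'I_(l + l)) : P :=
  match split i with
  | inl j => \sum_(k < l) (invmx w) j k *: xvar k
  | inr j => \sum_(k < l) w k j *: yvar k
  end.
Definition act (w : 'M[C]_l) (p : P) : P :=
  p \mPo [tuple act_subst w i | i < l + l].

Definition invariant (W : seq 'M[C]_l) (p : P) :=
  forall w, w \in W -> act w p = p.
Definition determinantal (W : seq 'M[C]_l) (p : P) :=
  forall w, w \in W -> act w p = \det w *: p.

Definition ideal_gen (S : P -> Prop) : P -> Prop := fun p =>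
  exists k (c s : 'I_k -> P), (forall i, S (s i)) /\ p = \sum_(i < k) c i * s i.
Definition ideal_mul (I J : P -> Prop) : P -> Prop :=
  ideal_gen (fun p => exists a b, [/\ I a, J b & p = a * b]).
Fixpoint ideal_pow (I : P -> Prop) (k : nat) : P -> Prop :=
  match k with
  | 0 => fun _ => True
  | k'.+1 => ideal_mul (ideal_pow I k') I
  end.

Definition idI (W : seq 'M[C]_l) : P -> Prop :=
  ideal_gen (fun p => invariant W p /\ p@_0%MM = 0).
Definition idA (W : seq 'M[C]_l) : P -> Prop := ideal_gen (determinantal W).
Definition idXY : P -> Prop :=
  ideal_gen (fun p => exists i : 'I_(l + l), p = 'X_i).

Definition xdeg (mo : 'X_{1..l + l}) : nat := (\sum_(i < l) mo (lshift l i))%N.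
Definition ydeg (mo : 'X_{1..l + l}) : nat := (\sum_(i < l) mo (rshift l i))%N.
Definition bihomog (a b : nat) (p : P) :=
  forall mo, mo \in msupp p -> xdeg mo = a /\ ydeg mo = b.

(* ---------- W-modules given as quotients U/U' of subspaces U' <= U of P,
   with action  w . [p] = chi(w) [w p]   (chi a one-dimensional twist) ---------- *)
(* the determinantal component e_det(U/U') of such a module, lifted to P:
   the p in U whose class [p] satisfies w.[p] = det(w) [p] *)
Definition det_component (W : seq 'M[C]_l) (chi : 'M[C]_l -> C)
    (U U' : P -> Prop) : P -> Prop := fun p =>
  U p /\ forall w, w \in W -> U' (chi w *: act w p - \det w *: p).

(* an isomorphism of bigraded W-modules U1/U2 (twist chi1) ~ U3/U4 (twist chi2),
   presented by a bigrading-preserving linear lift f : P -> P *)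
Definition bigraded_Wmod_iso (W : seq 'M[C]_l)
    (U1 U2 : P -> Prop) (chi1 : 'M[C]_l -> C)
    (U3 U4 : P -> Prop) (chi2 : 'M[C]_l -> C) :=
  exists f : P -> P,
  linear f /\
      (forall a b p, bihomog a b p -> bihomog a b (f p)) /\
      (forall p, U1 p -> U3 (f p)) /\
      (forall p, U2 p -> U4 (f p)) /\
      (forall p, U1 p -> U4 (f p) -> U2 p) /\
      (forall q, U3 q -> exists p, U1 p /\ U4 (f p - q)) /\
      (forall w p, w \in W -> U1 p ->
         U4 (f (chi1 w *: act w p) - chi2 w *: act w (f p))).

Definition eps_pow (k : int) (w : 'M[C]_l) : C := (\det w) ^ k.

End Defs.

(* Main.v *)
Require Import Defs.
From HB Require Import structures.
From mathcomp Require Import all_boot all_order all_algebra.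
From mathcomp Require Import mpoly.
Import Order.TTheory GRing.Theory Num.Theory.
Local Open Scope ring_scope.
Set Implicit Arguments. Unset Strict Implicit. Unset Printing Implicit Defensive.

(* The isomorphism is induced by the twisted Reynolds operator
     pi_m p = |W|^-1 \sum_w det(w)^-m (w p),
   the projector onto the det^m-semi-invariants.  Its key property is
   pi_(i+j) (c g) = pi_i c * g  whenever g is a det^j-semi-invariant.
   Since A^(m-1) is generated by det^(m-1)-semi-invariants and A by
   det-semi-invariants, pi_m maps A^(m-1) into A^m and A^(m-1) I into
   <x,y> A^m (pi_m (c g i) = i * (pi_1 c * g) for i invariant);
   conversely pi_m maps <x,y> A^m back into A^(m-1) I, the factor
   pi_0 (e c) being an invariant without constant term.  An element of
   the determinantal component of DR^(m) is congruent to its own image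
   under pi_m modulo A^(m-1) I, which gives injectivity, and every
   q in A^m satisfies q = pi_m q modulo <x,y> A^m, because c - pi_0 c
   has no constant term; this gives surjectivity. *)

Lemma comp_mpoly_comp (R : comNzRingType) a b c (p : {mpoly R[a]})
    (lq : a.-tuple {mpoly R[b]}) (lr : b.-tuple {mpoly R[c]}) :
  (p \mPo lq) \mPo lr = p \mPo [tuple tnth lq i \mPo lr | i < a].
Proof.
elim/mpolyind: p => [|x m p _ _ IHp]; first by rewrite !comp_mpoly0.
rewrite !comp_mpolyD !comp_mpolyZ IHp !comp_mpolyX rmorph_prod /=.
by congr (_ *: _ + _); apply: eq_bigr => i _; rewrite rmorphXn tnth_mktuple.
Qed.

Lemma invmxM (R : comUnitRingType) n (v w : 'M[R]_n) :
  v \in unitmx -> w \in unitmx -> invmx (v *m w) = invmx w *m invmx v.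
Proof.
move=> uv uw; have uvw : v *m w \in unitmx by rewrite unitmx_mul uv uw.
have vwK : v *m w *m (invmx w *m invmx v) = 1%:M.
  by rewrite -mulmxA (mulmxA w) mulmxV // mul1mx mulmxV.
by rewrite -[LHS]mulmx1 -vwK mulmxA mulVmx // mul1mx.
Qed.

Section Ideals.
Variables (C : numClosedFieldType) (l : nat).
Local Notation P := {mpoly C[l + l]}.
Implicit Types (S T I : P -> Prop) (p q : P).

Lemma ideal_gen0 S : ideal_gen S 0.
Proof. by exists 0%N, (fun _ => 0), (fun _ => 0); split=> [[]|]; rewrite ?big_ord0. Qed.

Lemma mem_ideal_gen S s : S s -> ideal_gen S s.
Proof.
by move=> Ss; exists 1%N, (fun _ => 1), (fun _ => s); rewrite big_ord1 mul1r.
Qed.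

Lemma ideal_genD S p q : ideal_gen S p -> ideal_gen S q -> ideal_gen S (p + q).
Proof.
move=> [k1 [c1 [s1 [Ss1 ->]]]] [k2 [c2 [s2 [Ss2 ->]]]].
exists (k1 + k2)%N, (fun i => match split i with inl a => c1 a | inr b => c2 b end).
exists (fun i => match split i with inl a => s1 a | inr b => s2 b end).
split=> [i|]; first by case: (split i).
rewrite big_split_ord /=; congr (_ + _); apply: eq_bigr => i _.
  by rewrite (unsplitK (inl i)).
by rewrite (unsplitK (inr i)).
Qed.

Lemma ideal_genMl S c p : ideal_gen S p -> ideal_gen S (c * p).
Proof.
move=> [k [c1 [s1 [Ss1 ->]]]]; exists k, (fun i => c * c1 i), s1; split=> //.
by rewrite mulr_sumr; apply: eq_bigr => i _; rewrite mulrA.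
Qed.

Lemma ideal_genZ S a p : ideal_gen S p -> ideal_gen S (a *: p).
Proof. by rewrite -mul_mpolyC; apply: ideal_genMl. Qed.

Lemma ideal_genN S p : ideal_gen S p -> ideal_gen S (- p).
Proof. by rewrite -scaleN1r; apply: ideal_genZ. Qed.

Lemma ideal_gen_sum S (J : eqType) (r : seq J) (F : J -> P) :
  (forall j, j \in r -> ideal_gen S (F j)) -> ideal_gen S (\sum_(j <- r) F j).
Proof.
move=> SF; rewrite big_seq; apply: (big_ind (ideal_gen S)) => //.
  exact: ideal_gen0.
exact: ideal_genD.
Qed.

Lemma ideal_gen_ind S (Q : P -> Prop) :
  Q 0 -> (forall p q, Q p -> Q q -> Q (p + q)) ->
  (forall c s, S s -> Q (c * s)) -> forall p, ideal_gen S p -> Q p.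
Proof.
move=> Q0 QD QM p [k [c [s [Ss ->]]]].
by apply: (big_ind Q) => // i _; apply: QM.
Qed.

Lemma ideal_gen_sub S T : (forall s, S s -> ideal_gen T s) ->
  forall p, ideal_gen S p -> ideal_gen T p.
Proof.
move=> ST; apply: ideal_gen_ind => [|p q|c s /ST]; last exact: ideal_genMl.
  exact: ideal_gen0.
exact: ideal_genD.
Qed.

Lemma ideal_gen_mul S T p q : ideal_gen S p -> ideal_gen T q ->
  ideal_gen (fun x => exists a b, [/\ S a, T b & x = a * b]) (p * q).
Proof.
move=> Sp Tq; elim/ideal_gen_ind: p / Sp => [|p1 p2 IH1 IH2|c s Ss].
- by rewrite mul0r; apply: ideal_gen0.
- by rewrite mulrDl; apply: ideal_genD.
rewrite -mulrA; apply: ideal_genMl.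
elim/ideal_gen_ind: q / Tq => [|q1 q2 IH1 IH2|d t Tt].
- by rewrite mulr0; apply: ideal_gen0.
- by rewrite mulrDr; apply: ideal_genD.
by rewrite mulrCA; apply/ideal_genMl/mem_ideal_gen; exists s, t.
Qed.

Lemma ideal_pow_zero I k : ideal_pow I k 0.
Proof. by case: k => [|k] //=; apply: ideal_gen0. Qed.

Lemma ideal_powD I k p q :
  ideal_pow I k p -> ideal_pow I k q -> ideal_pow I k (p + q).
Proof. by case: k => [|k] //=; apply: ideal_genD. Qed.

Lemma ideal_powMl I k c p : ideal_pow I k p -> ideal_pow I k (c * p).
Proof. by case: k => [|k] //=; apply: ideal_genMl. Qed.

Lemma ideal_powS_sub I k p : ideal_pow I k.+1 p -> ideal_pow I k p.
Proof.
elim/ideal_gen_ind=> [|p1 p2|c s [a [b [Ia _ ->]]]]; first exact: ideal_pow_zero.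
  exact: ideal_powD.
by rewrite mulrCA mulrC; apply: ideal_powMl.
Qed.

End Ideals.

Section Action.
Variables (C : numClosedFieldType) (l : nat).
Local Notation P := {mpoly C[l + l]}.
Local Notation idXY := (@idXY C l).
Local Notation xvar := (@xvar C l).
Local Notation yvar := (@yvar C l).
Implicit Types (p q : P) (v w : 'M[C]_l).

HB.instance Definition _ w :=
  GRing.LRMorphism.copy (act w) (comp_mpoly [tuple act_subst w i | i < l + l]).

Lemma actX w i : act w 'X_i = act_subst w i.
Proof. by rewrite /act comp_mpolyXU -tnth_nth tnth_mktuple. Qed.

Lemma act_xvar w j : act w (xvar j) = \sum_(k < l) invmx w j k *: xvar k.
Proof. by rewrite actX /act_subst (unsplitK (inl j)). Qed.

Lemma act_yvar w j : act w (yvar j) = \sum_(k < l) w k j *: yvar k.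
Proof. by rewrite actX /act_subst (unsplitK (inr j)). Qed.

Lemma act_comp v w p : v \in unitmx -> w \in unitmx ->
  act v (act w p) = act (v *m w) p.
Proof.
move=> uv uw; rewrite {1 2}/act comp_mpoly_comp.
congr (comp_mpoly _ p); apply: eq_from_tnth => i; rewrite !tnth_mktuple.
rewrite -/(act v _) /act_subst; case: (split i) => j; rewrite raddf_sum /=.
  under eq_bigr do rewrite linearZZ /= act_xvar scaler_sumr.
  rewrite exchange_big (invmxM uv uw); apply: eq_bigr => k _.
  by rewrite mxE scaler_suml; apply: eq_bigr => k' _; rewrite scalerA.
under eq_bigr do rewrite linearZZ /= act_yvar scaler_sumr.
rewrite exchange_big; apply: eq_bigr => k _.
by rewrite mxE scaler_suml; apply: eq_bigr => k' _; rewrite scalerA mulrC.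
Qed.

Lemma idXY_mcoeff0 p : idXY p -> p@_0 = 0.
Proof.
elim/ideal_gen_ind=> [|p1 p2 IH1 IH2|c s [i ->]]; first exact: mcoeff0.
  by rewrite mcoeffD IH1 IH2 addr0.
have /negPf Ui_neq0 : U_(i)%MM != 0%MM.
  by apply/eqP => /mnmP/(_ i); rewrite mnm1E mnm0E eqxx.
by rewrite (rmorphM (mcoeff 0%MM)) /= mcoeffX Ui_neq0 mulr0.
Qed.

Lemma idXY_mpolyX (m : 'X_{1..l + l}) : m != 0%MM -> idXY 'X_[m].
Proof.
move=> m_neq0; have [i mi_gt0 | mi0] := pickP (fun i => 0 < m i)%N; last first.
  by case/eqP: m_neq0; apply/mnmP => i; rewrite mnm0E; case: (m i) (mi0 i).
rewrite mpolyXE_id (bigD1 i) //= -(prednK mi_gt0) exprS -mulrA mulrC.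
by apply/ideal_genMl/mem_ideal_gen; exists i.
Qed.

Lemma idXY_sub_mcoeff0 p : idXY (p - (p@_0)%:MP).
Proof.
elim/mpolyind: p => [|c m p _ _ IHp].
  by rewrite mcoeff0 subr0; apply: ideal_gen0.
have -> : c *: 'X_[m] + p - ((c *: 'X_[m] + p)@_0)%:MP =
    c *: ('X_[m] - ((m == 0%MM)%:R)%:MP) + (p - (p@_0)%:MP).
  rewrite mcoeffD mcoeffZ mcoeffX mpolyCD mpolyCM mul_mpolyC scalerBr.
  by rewrite opprD !addrA; congr (_ + _); rewrite addrAC.
apply/ideal_genD/IHp/ideal_genZ.
have [->|m_neq0] := eqVneq m 0%MM; first by rewrite mpolyX0 subrr; apply: ideal_gen0.
by rewrite subr0; apply: idXY_mpolyX.
Qed.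

Lemma idXYP p : idXY p <-> p@_0 = 0.
Proof.
split; first exact: idXY_mcoeff0.
by move=> p0; have := idXY_sub_mcoeff0 p; rewrite p0 subr0.
Qed.

Lemma act_idXY w p : idXY p -> idXY (act w p).
Proof.
have lin_form (J : 'I_l -> 'I_(l + l)) (a : 'I_l -> C) :
    idXY (\sum_(k < l) a k *: 'X_(J k)).
  by apply: ideal_gen_sum => k _; apply/ideal_genZ/mem_ideal_gen; exists (J k).
elim/ideal_gen_ind=> [|p1 p2|c s [i ->]]; first by rewrite raddf0; apply: ideal_gen0.
  by rewrite raddfD; apply: ideal_genD.
rewrite rmorphM /= actX; apply: ideal_genMl; rewrite /act_subst.
case: (split i) => j; first exact: (lin_form (@lshift l l)).
exact: (lin_form (@rshift l l) (fun k => w k j)).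
Qed.

Lemma mcoeff0_act w p : (act w p)@_0 = p@_0.
Proof.
have /idXY_mcoeff0 := act_idXY w (idXY_sub_mcoeff0 p).
by rewrite raddfB /= /act comp_mpolyC mcoeffB mcoeffC eqxx mulr1 => /subr0_eq.
Qed.

End Action.

Section Bigrading.
Variables (C : numClosedFieldType) (l : nat).
Local Notation P := {mpoly C[l + l]}.
Local Notation bihomog := (@bihomog C l).
Local Notation xvar := (@xvar C l).
Local Notation yvar := (@yvar C l).
Implicit Types (p q : P) (w : 'M[C]_l) (mo : 'X_{1..l + l}).

Lemma bihomog0 a b : bihomog a b 0.
Proof. by move=> mo; rewrite mcoeff_msupp mcoeff0 eqxx. Qed.

Lemma bihomogD a b p q : bihomog a b p -> bihomog a b q -> bihomog a b (p + q).
Proof. by move=> hp hq mo /msuppD_le; rewrite mem_cat => /orP[/hp|/hq]. Qed.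

Lemma bihomogZ a b c p : bihomog a b p -> bihomog a b (c *: p).
Proof. by move=> hp mo /msuppZ_le /hp. Qed.

Lemma bihomog_sum a b J (r : seq J) (F : J -> P) :
  (forall j, bihomog a b (F j)) -> bihomog a b (\sum_(j <- r) F j).
Proof.
by move=> hF; apply: (big_ind (bihomog a b)) => //; [exact: bihomog0 | exact: bihomogD].
Qed.

Lemma xdegD mo1 mo2 : xdeg (mo1 + mo2)%MM = (xdeg mo1 + xdeg mo2)%N.
Proof. by rewrite /xdeg -big_split; apply: eq_bigr => i _; rewrite mnmDE. Qed.

Lemma ydegD mo1 mo2 : ydeg (mo1 + mo2)%MM = (ydeg mo1 + ydeg mo2)%N.
Proof. by rewrite /ydeg -big_split; apply: eq_bigr => i _; rewrite mnmDE. Qed.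

Lemma bihomog1 : bihomog 0 0 1.
Proof.
move=> mo; rewrite msupp1 inE => /eqP ->.
by rewrite /xdeg /ydeg !big1 // => i _; rewrite mnm0E.
Qed.

Lemma bihomogM a b c d p q : bihomog a b p -> bihomog c d q ->
  bihomog (a + c) (b + d) (p * q).
Proof.
move=> hp hq mo /msuppM_le /allpairsP[[mo1 mo2] [/= /hp[<- <-] /hq[<- <-] ->]].
by rewrite xdegD ydegD.
Qed.

Lemma bihomogX a b p k : bihomog a b p -> bihomog (a * k) (b * k) (p ^+ k).
Proof.
move=> hp; elim: k => [|k IHk]; first by rewrite !muln0 expr0; exact: bihomog1.
by rewrite exprS !mulnS; apply: bihomogM.
Qed.

Lemma bihomog_xvar k : bihomog 1 0 (xvar k).
Proof.
move=> mo; rewrite msuppX inE => /eqP ->; split.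
  rewrite /xdeg (bigD1 k) //= big1 => [|i ik]; first by rewrite mnm1E eqxx.
  by rewrite mnm1E eq_lshift eq_sym (negbTE ik).
by rewrite /ydeg big1 // => i _; rewrite mnm1E eq_lrshift.
Qed.

Lemma bihomog_yvar k : bihomog 0 1 (yvar k).
Proof.
move=> mo; rewrite msuppX inE => /eqP ->; split.
  by rewrite /xdeg big1 // => i _; rewrite mnm1E eq_rlshift.
rewrite /ydeg (bigD1 k) //= big1 => [|i ik]; first by rewrite mnm1E eqxx.
by rewrite mnm1E eq_rshift eq_sym (negbTE ik).
Qed.

Definition xweight (i : 'I_(l + l)) : nat := if split i is inl _ then 1 else 0.
Definition yweight (i : 'I_(l + l)) : nat := if split i is inl _ then 0 else 1.

Lemma xdegE mo : xdeg mo = (\sum_i xweight i * mo i)%N.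
Proof.
rewrite big_split_ord /= [X in (_ + X)%N]big1 ?addn0 => [|i _]; last first.
  by rewrite /xweight (unsplitK (inr i)).
by apply: eq_bigr => i _; rewrite /xweight (unsplitK (inl i)) mul1n.
Qed.

Lemma ydegE mo : ydeg mo = (\sum_i yweight i * mo i)%N.
Proof.
rewrite big_split_ord /= [X in (X + _)%N]big1 ?add0n => [|i _]; last first.
  by rewrite /yweight (unsplitK (inl i)).
by apply: eq_bigr => i _; rewrite /yweight (unsplitK (inr i)) mul1n.
Qed.

Lemma bihomog_act_subst w i : bihomog (xweight i) (yweight i) (act_subst w i).
Proof.
rewrite /xweight /yweight /act_subst; case: (split i) => j.
  by apply: bihomog_sum => k; apply/bihomogZ/bihomog_xvar.
by apply: bihomog_sum => k; apply/bihomogZ/bihomog_yvar.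
Qed.

Lemma bihomog_act w a b p : bihomog a b p -> bihomog a b (act w p).
Proof.
move=> hp; rewrite (mpolyE p) raddf_sum /= big_seq.
apply: (big_ind (bihomog a b)) => [|*|mo /hp[<- <-]]; first exact: bihomog0.
  exact: bihomogD.
rewrite linearZZ /=; apply: bihomogZ; rewrite /act comp_mpolyX xdegE ydegE.
apply: (big_rec3 (fun a b p => bihomog a b p)) => [|i a' b' q _ hq].
  exact: bihomog1.
by rewrite tnth_mktuple; apply/bihomogM/hq/bihomogX/bihomog_act_subst.
Qed.

End Bigrading.

Section Reynolds.
Variables (C : numClosedFieldType) (l : nat) (W : seq 'M[C]_l).
Hypothesis W1 : 1%:M \in W.
Hypothesis WM : forall a b, a \in W -> b \in W -> a *m b \in W.
Hypothesis WU : forall a, a \in W -> a \in unitmx.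
Hypothesis WV : forall a, a \in W -> invmx a \in W.
Local Notation P := {mpoly C[l + l]}.
Implicit Types (p q g : P) (v w : 'M[C]_l).

Definition semi_invariant k g := forall w, w \in W -> act w g = \det w ^+ k *: g.

(* Averaging over [undup W], as W is only a list of matrices. *)
Definition reynolds k p : P :=
  (size (undup W))%:R^-1 *: \sum_(w <- undup W) (\det w)^-1 ^+ k *: act w p.

Lemma reynolds_is_linear k : linear (reynolds k).
Proof.
move=> a p q; rewrite /reynolds [a *: (_ *: _)]scalerA mulrC -scalerA -scalerDr.
f_equal; rewrite scaler_sumr -big_split /=; apply: eq_bigr => w _.
by rewrite raddfD /= linearZZ scalerDr !scalerA mulrC.
Qed.

HB.instance Definition _ k :=
  GRing.isLinear.Build C P P *:%R (reynolds k) (reynolds_is_linear k).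

Lemma det_neq0 w : w \in W -> \det w != 0.
Proof. by move/WU; rewrite unitmxE unitfE. Qed.

Lemma size_undup_neq0 : (size (undup W))%:R != 0 :> C.
Proof.
by rewrite pnatr_eq0 -lt0n -has_predT; apply/hasP; exists 1%:M; rewrite ?mem_undup.
Qed.

Lemma perm_undup_mulmxl v : v \in W -> perm_eq (map (mulmx v) (undup W)) (undup W).
Proof.
move=> vW; apply: uniq_perm; rewrite ?undup_uniq //.
  by rewrite (map_inj_uniq (can_inj (mulKmx (WU vW)))) undup_uniq.
move=> x; apply/mapP/idP => [[y yW ->]|xW].
  by rewrite mem_undup WM // -mem_undup.
exists (invmx v *m x); first by rewrite mem_undup WM ?WV // -mem_undup.
by rewrite mulKVmx ?WU.
Qed.

Lemma perm_undup_mulmxr v : v \in W -> perm_eq (map (mulmx^~ v) (undup W)) (undup W).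
Proof.
move=> vW; apply: uniq_perm; rewrite ?undup_uniq //.
  by rewrite (map_inj_uniq (can_inj (mulmxK (WU vW)))) undup_uniq.
move=> x; apply/mapP/idP => [[y yW ->]|xW].
  by rewrite mem_undup WM // -mem_undup.
exists (x *m invmx v); first by rewrite mem_undup WM ?WV // -mem_undup.
by rewrite mulmxKV ?WU.
Qed.

Lemma inv_det_powM v w k : \det v != 0 ->
  \det v ^+ k * (\det (v *m w))^-1 ^+ k = (\det w)^-1 ^+ k.
Proof.
by move=> v0; rewrite det_mulmx invfM exprMn mulrA -exprMn mulfV // expr1n mul1r.
Qed.

Lemma semi_invariant_reynolds k p : semi_invariant k (reynolds k p).
Proof.
move=> v vW; rewrite /reynolds linearZZ [X in _ *: X = _]raddf_sum.
rewrite scalerA (mulrC (_ ^+ k)) -scalerA; apply: congr1.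
rewrite -[in RHS](perm_big _ (perm_undup_mulmxl vW)) big_map scaler_sumr.
apply: eq_big_seq => w; rewrite mem_undup => wW.
by rewrite [LHS]linearZZ /= act_comp ?WU // scalerA inv_det_powM ?det_neq0.
Qed.

Lemma reynolds_act k v p : v \in W ->
  reynolds k (act v p) = \det v ^+ k *: reynolds k p.
Proof.
move=> vW; rewrite /reynolds scalerA (mulrC (_ ^+ k)) -scalerA; apply: congr1.
rewrite -[in RHS](perm_big _ (perm_undup_mulmxr vW)) big_map scaler_sumr.
apply: eq_big_seq => w; rewrite mem_undup => wW.
rewrite act_comp ?WU // scalerA det_mulmx (mulrC (\det w)) -det_mulmx.
by rewrite inv_det_powM ?det_neq0.
Qed.

Lemma reynolds_id k g : semi_invariant k g -> reynolds k g = g.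
Proof.
move=> gk; rewrite /reynolds (eq_big_seq (fun _ => g)) => [|w]; last first.
  rewrite mem_undup => wW; rewrite gk // scalerA -exprMn mulVf ?det_neq0 //.
  by rewrite expr1n scale1r.
rewrite big_const_seq count_predT iter_addr_0 -scaler_nat scalerA.
by rewrite mulVf ?size_undup_neq0 ?scale1r.
Qed.

Lemma reynolds_mulr i j q g : semi_invariant j g ->
  reynolds (i + j) (q * g) = reynolds i q * g.
Proof.
move=> gj; rewrite /reynolds -scalerAl mulr_suml; apply: congr1.
apply: eq_big_seq => w; rewrite mem_undup => wW.
rewrite rmorphM /= gj // -scalerAr -scalerAl !scalerA; congr (_ *: _).
by rewrite exprD -mulrA -exprMn mulVf ?det_neq0 // expr1n mulr1.
Qed.

Lemma semi_invariantM i j a b :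
  semi_invariant i a -> semi_invariant j b -> semi_invariant (i + j) (a * b).
Proof.
move=> ai bj w wW; rewrite rmorphM /= ai // bj // -scalerAr -scalerAl scalerA.
by rewrite exprD mulrC.
Qed.

Lemma semi_invariant1 : semi_invariant 0 1.
Proof. by move=> w wW; rewrite rmorph1 expr0 scale1r. Qed.

Lemma invariant_semi_invariant0 g : Defs.invariant W g <-> semi_invariant 0 g.
Proof.
by split=> gW w wW; have := gW w wW; rewrite expr0 scale1r.
Qed.

Lemma determinantal_semi_invariant1 g : determinantal W g <-> semi_invariant 1 g.
Proof. by split=> gW w wW; have := gW w wW; rewrite expr1. Qed.

Lemma mcoeff0_reynolds0 q : (reynolds 0 q)@_0 = q@_0.
Proof.
rewrite /reynolds mcoeffZ raddf_sum /= (eq_bigr (fun _ => q@_0)) => [|w _]; last first.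
  by rewrite expr0 scale1r mcoeff0_act.
rewrite big_const_seq count_predT iter_addr_0 -[q@_0 *+ _]mulr_natl mulrA.
by rewrite mulVf ?size_undup_neq0 ?mul1r.
Qed.

Local Notation A := (idA W).
Local Notation xy_ideal := (@idXY C l).

Lemma idA_pow_semi_invariant_gen k p : ideal_pow A k p ->
  ideal_gen (fun g => semi_invariant k g /\ ideal_pow A k g) p.
Proof.
elim: k p => [|k IHk] p Ap.
  rewrite -[p]mulr1; apply/ideal_genMl/mem_ideal_gen.
  by split=> //; exact: semi_invariant1.
elim/ideal_gen_ind: p / Ap => [|p1 p2|c s [a [b [Aa Ab ->]]]]; first exact: ideal_gen0.
  exact: ideal_genD.
apply/ideal_genMl/(ideal_gen_sub _ (ideal_gen_mul (IHk a Aa) Ab)).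
move=> _ [g [d [[gk Ag] Ad ->]]]; apply: mem_ideal_gen; split.
  by rewrite -addn1; apply: semi_invariantM => //; apply/determinantal_semi_invariant1.
by apply: mem_ideal_gen; exists g, d; split=> //; apply: mem_ideal_gen.
Qed.

Lemma reynolds_idA_pow k p : ideal_pow A k p -> ideal_pow A k.+1 (reynolds k.+1 p).
Proof.
move/idA_pow_semi_invariant_gen.
elim/ideal_gen_ind=> [|p1 p2|c g [gk Ag]]; first by rewrite raddf0; apply: ideal_gen0.
  by rewrite raddfD; apply: ideal_genD.
rewrite -add1n reynolds_mulr // mulrC; apply: mem_ideal_gen; exists g, (reynolds 1 c).
split=> //; apply/mem_ideal_gen/determinantal_semi_invariant1/semi_invariant_reynolds.
Qed.

Lemma bihomog_reynolds k a b p : bihomog a b p -> bihomog a b (reynolds k p).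
Proof.
move=> hp; apply/bihomogZ/bihomog_sum => w.
exact/bihomogZ/bihomog_act.
Qed.

Section DiagonalCoinvariants.
Variable n : nat.
Local Notation AI := (ideal_mul (ideal_pow A n) (idI W)).
Local Notation XYA := (ideal_mul xy_ideal (ideal_pow A n.+1)).
Local Notation chi := (eps_pow (1 - n.+1%:Z)).

Lemma eps_pow_det w : w \in W -> chi w * \det w ^+ n.+1 = \det w.
Proof.
move=> wW; have := expfzDr (1 - n.+1%:Z) n.+1%:Z (det_neq0 wW).
by rewrite subrK expr1z => <-.
Qed.

Lemma idA_pow_idI_gen p : AI p -> ideal_gen (fun x => exists g i,
  [/\ semi_invariant n g, ideal_pow A n g, Defs.invariant W i /\ i@_0 = 0 & x = g * i]) p.
Proof.
apply: ideal_gen_sub => _ [a [b [Aa Ib ->]]].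
apply: (ideal_gen_sub _ (ideal_gen_mul (idA_pow_semi_invariant_gen Aa) Ib)).
by move=> _ [g [i [[gn Ag] Ii ->]]]; apply: mem_ideal_gen; exists g, i.
Qed.

Lemma reynolds_idA_pow_mul_idI p : AI p -> XYA (reynolds n.+1 p).
Proof.
move/idA_pow_idI_gen; elim/ideal_gen_ind=> [|p1 p2|c _ [g [i [gn Ag [Ii i0] ->]]]].
- by rewrite raddf0; apply: ideal_gen0.
- by rewrite raddfD; apply: ideal_genD.
have i_0 : semi_invariant 0 i by apply/invariant_semi_invariant0.
rewrite mulrA mulrAC -add1n reynolds_mulr //.
have := reynolds_mulr 1 c i_0; rewrite addn0 => ->.
rewrite -mulrA mulrC; apply: mem_ideal_gen; exists i, (g * reynolds 1 c).
split; [exact/idXYP | | by rewrite mulrA].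
apply: mem_ideal_gen; exists g, (reynolds 1 c); split=> //.
exact/mem_ideal_gen/determinantal_semi_invariant1/semi_invariant_reynolds.
Qed.

(* [p - pi p] averages the differences [det(w)^-(n+1) (w p) - p], each a
   multiple of [chi w (w p) - det w p]. *)
Lemma sub_reynolds_det_component p :
    (forall w, w \in W -> AI (chi w *: act w p - \det w *: p)) ->
  AI (p - reynolds n.+1 p).
Proof.
move=> pdet; have -> : p - reynolds n.+1 p = - ((size (undup W))%:R^-1 *:
    \sum_(w <- undup W) ((\det w)^-1 ^+ n.+1 *: act w p - p)).
  rewrite big_split /= sumrN big_const_seq count_predT iter_addr_0 scalerDr scalerN.
  by rewrite -scaler_nat scalerA mulVf ?size_undup_neq0 // scale1r opprD opprK addrC.
apply/ideal_genN/ideal_genZ/ideal_gen_sum => w; rewrite mem_undup => wW.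
have d_neq0 := det_neq0 wW.
have -> : (\det w)^-1 ^+ n.+1 *: act w p - p =
    (\det w)^-1 *: (chi w *: act w p - \det w *: p).
  rewrite scalerBr !scalerA mulVf // scale1r; congr (_ *: _ - _).
  apply: (mulIf (expf_neq0 n.+1 d_neq0)); rewrite -exprMn mulVf // expr1n.
  by rewrite -mulrA eps_pow_det // mulVf.
exact/ideal_genZ/pdet.
Qed.

Lemma reynolds_idXY_mul_idA_pow q : XYA q -> AI (reynolds n.+1 q).
Proof.
elim/ideal_gen_ind=> [|q1 q2|c _ [x [a [XYx Aa ->]]]].
- by rewrite raddf0; apply: ideal_gen0.
- by rewrite raddfD; apply: ideal_genD.
rewrite mulrA; have : xy_ideal (c * x) by apply: ideal_genMl.
move: (c * x) => e XYe; move/idA_pow_semi_invariant_gen: Aa; move: a.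
apply: ideal_gen_ind => [|a1 a2|d g [gn Ag]].
- by rewrite mulr0 raddf0; apply: ideal_gen0.
- by rewrite mulrDr raddfD; apply: ideal_genD.
rewrite mulrA -[n.+1]add0n reynolds_mulr // mulrC.
apply: mem_ideal_gen; exists g, (reynolds 0 (e * d)); split.
- exact: ideal_powS_sub.
- apply: mem_ideal_gen; split.
    exact/invariant_semi_invariant0/semi_invariant_reynolds.
  by rewrite mcoeff0_reynolds0 mulrC; apply/idXYP/ideal_genMl.
- by [].
Qed.

Lemma reynolds_sub_idA_pow q : ideal_pow A n.+1 q -> XYA (reynolds n.+1 q - q).
Proof.
move/idA_pow_semi_invariant_gen.
elim/ideal_gen_ind=> [|q1 q2|c g [gn Ag]].
- by rewrite raddf0 subr0; apply: ideal_gen0.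
- by rewrite raddfD opprD addrACA; apply: ideal_genD.
rewrite -[n.+1]add0n reynolds_mulr // -mulrBl; apply: mem_ideal_gen.
exists (reynolds 0 c - c), g; split=> //.
by apply/idXYP; rewrite mcoeffB mcoeff0_reynolds0 subrr.
Qed.

Lemma reynolds_bigraded_Wmod_iso : bigraded_Wmod_iso W
    (det_component W chi (ideal_pow A n) AI) AI chi (ideal_pow A n.+1) XYA chi.
Proof.
have pi_pi p : reynolds n.+1 (reynolds n.+1 p) = reynolds n.+1 p.
  exact/reynolds_id/semi_invariant_reynolds.
exists (reynolds n.+1); split; [exact: linearP|]; split; [exact: bihomog_reynolds|].
split; first by move=> p [Ap _]; apply: reynolds_idA_pow.
split; first exact: reynolds_idA_pow_mul_idI.
split.
  move=> p [_ pdet] /reynolds_idXY_mul_idA_pow; rewrite pi_pi => AIpi.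
  rewrite -(subrK (reynolds n.+1 p) p); apply: ideal_genD => //.
  exact: sub_reynolds_det_component.
split.
  move=> q Aq; exists (reynolds n.+1 q).
  split; last by rewrite pi_pi; apply: reynolds_sub_idA_pow.
  split; first exact/ideal_powS_sub/reynolds_idA_pow/ideal_powS_sub.
  move=> w wW; rewrite semi_invariant_reynolds // scalerA eps_pow_det // subrr.
  exact: ideal_gen0.
move=> w p wW _; rewrite linearZZ /= reynolds_act // semi_invariant_reynolds // subrr.
exact: ideal_gen0.
Qed.

End DiagonalCoinvariants.
End Reynolds.

Theorem theorem3p4 (C : numClosedFieldType) (l : nat) (W : seq 'M[C]_l) (m : nat) :
  complex_reflection_group W -> (1 <= m)%N ->
  bigraded_Wmod_iso W
    (det_component W (eps_pow (1 - m%:Z))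
       (ideal_pow (idA W) m.-1)
       (ideal_mul (ideal_pow (idA W) m.-1) (idI W)))
    (ideal_mul (ideal_pow (idA W) m.-1) (idI W))
    (eps_pow (1 - m%:Z))
    (ideal_pow (idA W) m)
    (ideal_mul (@idXY C l) (ideal_pow (idA W) m))
    (eps_pow (1 - m%:Z)).
Proof.
move=> [W1 WM WUV _ _]; case: m => [//|n] _.
have WU a : a \in W -> a \in unitmx by case/WUV.
have WV a : a \in W -> invmx a \in W by case/WUV.
exact: (reynolds_bigraded_Wmod_iso W1 WM WU WV n).
Qed.
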